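(* Let $X\in(L^2(\Omega,\mathbb R^{n_x}))^{\mathbb N}$, $V\in(L^2(\Omega,\mathbb R^{n_v}))^{\mathbb N}$ and $Y\in(L^2(\Omega,\mathbb R^{n_y}))^{\mathbb N}$ with corresponding expansion coefficients (with respect to the fixed orthogonal basis $(\phi^i)_{i\in\mathbb N}$ of $L^2(\Omega,\mathbb R)$) $\mathsf x\in(\ell^2(\mathbb R^{n_x}))^{\mathbb N}$, $\mathsf v\in(\ell^2(\mathbb R^{n_v}))^{\mathbb N}$ and $\mathsf y\in(\ell^2(\mathbb R^{n_y}))^{\mathbb N}$, and, for $\omega\in\Omega$, realizations $(X(\omega),V(\omega),Y(\omega))\in(\mathbb R^{n_x}\times\mathbb R^{n_v}\times\mathbb R^{n_y})^{\mathbb N}$. Then, for every $T\in\mathbb N\cup\{\infty\}$, the following statements are equivalent (for finite $T$, membership in a finite-horizon behavior refers to the restriction of the trajectory to $[0,T]$): (i) $(X(\omega),V(\omega),Y(\omega))\in\mathfrak B_T$ for $\mathbb P$-almost all $\omega\in\Omega$; (ii) $(X,V,Y)\in\mathfrak S_T$; (iii) $(\mathsf x,\mathsf v,\mathsf y)\in\mathfrak C_T$; (iv) $(\mathsf x^i,\mathsf v^i,\mathsf y^i)\in\mathfrak B_T$ for all $i\in\mathbb N$. A similar proposition holds for the manifest behaviors, i.e. the following are equivalent: $(V(\omega),Y(\omega))\in\mathfrak B_T^{\text{i/o}}$ for $\mathbb P$-almost all $\omega\in\Omega$; $(V,Y)\in\mathfrak S_T^{\text{i/o}}$; $(\mathsf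 v,\mathsf y)\in\mathfrak C_T^{\text{i/o}}$; $(\mathsf v^i,\mathsf y^i)\in\mathfrak B_T^{\text{i/o}}$ for all $i\in\mathbb N$.
   Context: $\mathbb N=\{0,1,2,\dots\}$. Fix real matrices $A\in\mathbb R^{n_x\times n_x}$, $\widetilde B\in\mathbb R^{n_x\times n_v}$, $C\in\mathbb R^{n_y\times n_x}$, $\widetilde D\in\mathbb R^{n_y\times n_v}$. Realization behavior: $\mathfrak B_\infty$ is the set of all $(x,v,y)$ with $x\in(\mathbb R^{n_x})^{\mathbb N}$, $v\in(\mathbb R^{n_v})^{\mathbb N}$, $y\in(\mathbb R^{n_y})^{\mathbb N}$ such that $x_{k+1}=Ax_k+\widetilde Bv_k$ and $y_k=Cx_k+\widetilde Dv_k$ for all $k\in\mathbb N$. Probability space: $(\Omega,\mathcal F,\mathbb P)$ is a separable probability space (i.e. $\mathcal F$ is generated by a countable family of sets). $L^2(\Omega,\mathbb R^d)$ is the Hilbert space of (equivalence classes of) $\mathbb R^d$-valued random variables of finite variance; equality means equality for $\mathbb P$-almost all $\omega$. $(\phi^i)_{i\in\mathbb N}$ is a fixed orthogonal basis of $L^2(\Omega,\mathbb R)$. The expansion coefficients of $Z\in L^2(\Omega,\mathbb R^d)$ are $\mathsf z^i=\mathbb E[\phi^iZ]/\mathbb E[\phi^i\phi^i]\in\mathbb R^d$, so that $Z=\sum_i\mathsf z^i\phi^i$ in $L^2$; for processes they are taken step-wise in time. $\ell^2(\mathbb R^d)=\{\mathsf z\in(\mathbb R^d)^{\mathbb N}:\sum_i(\mathsf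 z^i)^\top\mathsf z^i<\infty\}$. Expansion coefficient behavior: for $\mathsf z=((\mathsf z_k^i)_{i\in\mathbb N})_{k\in\mathbb N}$ ($k$ time, $i$ expansion index) write $\mathsf z^i=(\mathsf z_k^i)_{k\in\mathbb N}$. $\mathfrak C_\infty$ is the set of all $(\mathsf x,\mathsf v,\mathsf y)$ with $\mathsf x\in(\ell^2(\mathbb R^{n_x}))^{\mathbb N}$, $\mathsf v\in(\ell^2(\mathbb R^{n_v}))^{\mathbb N}$, $\mathsf y\in(\ell^2(\mathbb R^{n_y}))^{\mathbb N}$ such that $(\mathsf x^i,\mathsf v^i,\mathsf y^i)\in\mathfrak B_\infty$ for all $i\in\mathbb N$. Random variable behavior: $\mathfrak S_\infty$ is the set of all $(X,V,Y)$ with $X\in(L^2(\Omega,\mathbb R^{n_x}))^{\mathbb N}$, $V\in(L^2(\Omega,\mathbb R^{n_v}))^{\mathbb N}$, $Y\in(L^2(\Omega,\mathbb R^{n_y}))^{\mathbb N}$ such that $(X(\omega),V(\omega),Y(\omega))\in\mathfrak B_\infty$ for $\mathbb P$-almost all $\omega$. Manifest behaviors: $\mathfrak B_\infty^{\text{i/o}}$ is the set of $(v,y)$ for which there is $x\in(\mathbb R^{n_x})^{\mathbb N}$ with $(x,v,y)\in\mathfrak B_\infty$; $\mathfrak C_\infty^{\text{i/o}}$ is the set of $(\mathsf v,\mathsf y)$ for which there is $\mathsf x\in(\ell^2(\mathbb R^{n_x}))^{\mathbb N}$ with $(\mathsf x,\mathsf v,\mathsf y)\in\mathfrak C_\infty$;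 $\mathfrak S_\infty^{\text{i/o}}$ is the set of $(V,Y)$ for which there is $X\in(L^2(\Omega,\mathbb R^{n_x}))^{\mathbb N}$ with $(X,V,Y)\in\mathfrak S_\infty$. Finite horizon: for $T\in\mathbb N$ and each of these behaviors, the subscript $T$ denotes the set of restrictions to $\{0,\dots,T\}$ of the elements of the corresponding infinite-horizon behavior. *)

(* Defs.v *)
From HB Require Import structures.
From mathcomp Require Import all_boot all_order all_algebra.
From mathcomp Require Import all_classical all_reals all_analysis.

Set Implicit Arguments.
Unset Strict Implicit.
Unset Printing Implicit Defensive.

Import Order.TTheory GRing.Theory Num.Theory.
Import numFieldNormedType.Exports.

Local Open Scope classical_set_scope.
Local Open Scope ring_scope.

(* A horizon is [Some N] for the time axis {0, ..., N} and [None] for the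
   infinite time axis. *)
Definition horizon : Type := option nat.

Definition time (T : horizon) : Type := if T is Some N then 'I_N.+1 else nat.

Definition instant (T : horizon) : time T -> nat :=
  match T with Some N => @nat_of_ord N.+1 | None => id end.

Definition restr (T : horizon) (U : Type) (z : nat -> U) : time T -> U :=
  fun k => z (instant k).
Arguments restr T {U} z _.

Definition restr2 (T : horizon) (U1 U2 : Type)
    (z : (nat -> U1) * (nat -> U2)) : (time T -> U1) * (time T -> U2) :=
  (restr T z.1, restr T z.2).
Arguments restr2 T {U1 U2} z.

Definition restr3 (T : horizon) (U1 U2 U3 : Type)
    (z : (nat -> U1) * (nat -> U2) * (nat -> U3)) :
    (time T -> U1) * (time T -> U2) * (time T -> U3) :=
  (restr T z.1.1, restr T z.1.2, restr T z.2).
Arguments restr3 T {U1 U2 U3} z.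

(* The sets of restrictions to the horizon [T]; restricting to [None] changes
   nothing, see [behavior2_None] and [behavior3_None]. *)
Definition behavior2 (T : horizon) (U1 U2 : Type)
    (S : set ((nat -> U1) * (nat -> U2))) :
    set ((time T -> U1) * (time T -> U2)) :=
  restr2 T @` S.
Arguments behavior2 T {U1 U2} S _.

Definition behavior3 (T : horizon) (U1 U2 U3 : Type)
    (S : set ((nat -> U1) * (nat -> U2) * (nat -> U3))) :
    set ((time T -> U1) * (time T -> U2) * (time T -> U3)) :=
  restr3 T @` S.
Arguments behavior3 T {U1 U2 U3} S _.

Lemma behavior2_None (U1 U2 : Type) (S : set ((nat -> U1) * (nat -> U2))) :
  behavior2 None S = S.
Proof.
by apply/seteqP; split=> [_ [[z1 z2] Sz <-]|[z1 z2] Sz] //; exists (z1, z2).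
Qed.

Lemma behavior3_None (U1 U2 U3 : Type)
    (S : set ((nat -> U1) * (nat -> U2) * (nat -> U3))) :
  behavior3 None S = S.
Proof.
apply/seteqP; split=> [_ [[[z1 z2] z3] Sz <-]|[[z1 z2] z3] Sz] //.
by exists (z1, z2, z3).
Qed.

Definition manifest (U1 U2 U3 : Type) (S : set (U1 * U2 * U3)) :
    set (U2 * U3) :=
  [set z | exists x, S (x, z.1, z.2)].

Definition realization_behavior (R : realType) (nx nv ny : nat)
    (A : 'M[R]_nx) (B : 'M[R]_(nx, nv)) (C : 'M[R]_(ny, nx))
    (D : 'M[R]_(ny, nv)) :
    set ((nat -> 'cV[R]_nx) * (nat -> 'cV[R]_nv) * (nat -> 'cV[R]_ny)) :=
  [set z | forall k, z.1.1 k.+1 = A *m z.1.1 k + B *m z.1.2 k /\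
                     z.2 k = C *m z.1.1 k + D *m z.1.2 k].

Definition ell2 (R : realType) (n : nat) (z : nat -> 'cV[R]_n) : Prop :=
  (\sum_(0 <= i <oo) (((z i)^T *m z i) 0 0)%:E < +oo)%E.

(* In a family of coefficients [z k i], [k] is the time and [i] the index of
   the expansion. *)
Definition coef_traj (U : Type) (z : nat -> nat -> U) (i : nat) : nat -> U :=
  fun k => z k i.

Definition coefficient_behavior (R : realType) (nx nv ny : nat)
    (A : 'M[R]_nx) (B : 'M[R]_(nx, nv)) (C : 'M[R]_(ny, nx))
    (D : 'M[R]_(ny, nv)) :
    set ((nat -> nat -> 'cV[R]_nx) * (nat -> nat -> 'cV[R]_nv) *
         (nat -> nat -> 'cV[R]_ny)) :=
  [set z | [/\ forall k, ell2 (z.1.1 k), forall k, ell2 (z.1.2 k),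
               forall k, ell2 (z.2 k) &
               forall i, realization_behavior A B C D
                 (coef_traj z.1.1 i, coef_traj z.1.2 i, coef_traj z.2 i)]].

Section RandomVariables.
Context (d : measure_display) (Omega : measurableType d) (R : realType).
Variable P : probability Omega R.

Definition countably_generated : Prop :=
  exists2 G : set (set Omega), countable G & @measurable d Omega = <<s G >>.

(* The entries are classes modulo P-almost sure equality, so Leibniz equality
   is almost sure equality. *)
Definition L2vec (n : nat) : Type := 'cV[LspaceType2 P]_n.

(* The value at [w] is that of the representatives chosen by the quotient; it
   depends on this choice on a P-null set only. *)
Definition realization (n : nat) (Z : nat -> L2vec n) (w : Omega) :
    nat -> 'cV[R]_n :=
  fun k => \col_j Z k j 0 w.

Definition inner (Z W : LspaceType2 P) : R :=
  fine 'E_P[fun w => (Z w : R) * (W w : R)].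

Definition orthogonal_basis (phi : nat -> LspaceType2 P) : Prop :=
  [/\ forall i, inner (phi i) (phi i) != 0,
      forall i j, i != j -> inner (phi i) (phi j) = 0 &
      forall (Z : LspaceType2 P) (e : R), 0 < e ->
        exists (n : nat) (c : 'I_n -> R),
          ('N[P]_2[EFin \o (fun w => (Z w : R) - \sum_(i < n) c i * phi i w)%R]
            < e%:E)%E].

Definition expansion_coef (phi : nat -> LspaceType2 P) (n : nat)
    (Z : L2vec n) : nat -> 'cV[R]_n :=
  fun i => \col_j (inner (phi i) (Z j 0) / inner (phi i) (phi i)).

Definition random_behavior (nx nv ny : nat)
    (A : 'M[R]_nx) (B : 'M[R]_(nx, nv)) (C : 'M[R]_(ny, nx))
    (D : 'M[R]_(ny, nv)) :
    set ((nat -> L2vec nx) * (nat -> L2vec nv) * (nat -> L2vec ny)) :=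
  [set Z | {ae P, forall w, realization_behavior A B C D
             (realization Z.1.1 w, realization Z.1.2 w, realization Z.2 w)}].

End RandomVariables.

Arguments random_behavior {d Omega R} P {nx nv ny} A B C D _.

(* Main.v *)
Require Import Defs.
From HB Require Import structures.
From mathcomp Require Import all_boot all_order all_algebra.
From mathcomp Require Import all_classical all_reals all_analysis.
From mathcomp Require Import measurable_realfun ring lra.

Set Implicit Arguments.
Unset Strict Implicit.
Unset Printing Implicit Defensive.

Import Order.TTheory GRing.Theory Num.Theory.
Import numFieldNormedType.Exports.

Local Open Scope classical_set_scope.
Local Open Scope ring_scope.

(** Every behavior in the statement is cut out by linear equations, and by the
    state recursion a trajectory is determined by its initial state and its
    input.  So membership of [(x, v, y)] in the behavior on a horizon [T] says
    that for each instant [k] of [T] both [x k] and [y k] equal fixed finite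
    linear combinations of [x 0] and [v 0, ..., v k] ([solves]), and every
    such finite trajectory extends beyond [T]
    ([behavior3_realizationP]).

    These combinations make sense over any module.  Take the module of
    square-integrable functions on the sample space, which contains
    representatives of all the classes involved.  There are two families of
    linear functionals on it: evaluation at a sample point [w], and the
    [i]-th expansion coefficient.  Since the basis is total, a function is
    killed by almost all functionals of the first family iff it is killed by
    all functionals of the second one ([null_coef_eval]).  As there are
    countably many equations, the almost sure validity of all of them
    coincides with their validity for every coefficient
    ([solves_transfer]).  It remains to extend solutions beyond the horizon
    within the random variables of finite variance and within the
    square-summable coefficients, which the state recursion does.

    For the manifest behaviors the state has to be found.  The row spans of
    [C, C A, C A^2, ...] stabilize, so an initial state explaining an
    input-output pair can be computed from finitely many values of that pair
    by matrices that do not depend on it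
    ([initial_state_reconstruction]).  The computed state is therefore square
    integrable (resp. square summable) as soon as the pair is
    ([common_initial_state]), which reduces the manifest equivalences to
    those of the full trajectories. *)

(** * Scalar matrices acting on columns over a module *)

Section ScalarMatrixAction.
Context (R : comNzRingType) (U : lmodType R).

Definition lmx (m n : nat) (M : 'M[R]_(m, n)) (Z : 'cV[U]_n) : 'cV[U]_m :=
  \col_i \sum_j M i j *: Z j 0.

Lemma lmxD (m n : nat) (M : 'M[R]_(m, n)) (Z W : 'cV[U]_n) :
  lmx M (Z + W) = lmx M Z + lmx M W.
Proof.
apply/colP => i; rewrite !mxE -big_split; apply: eq_bigr => j _.
by rewrite mxE scalerDr.
Qed.

Lemma suml_lmx (m n : nat) (I : Type) (r : seq I) (p : pred I)
    (M : I -> 'M[R]_(m, n)) (Z : 'cV[U]_n) :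
  lmx (\sum_(i <- r | p i) M i) Z = \sum_(i <- r | p i) lmx (M i) Z.
Proof.
apply: (big_morph (fun M => lmx M Z)) => [M1 M2|]; apply/colP => i.
  rewrite !mxE -big_split; apply: eq_bigr => j _.
  by rewrite mxE scalerDl.
by rewrite !mxE big1// => j _; rewrite mxE scale0r.
Qed.

Lemma lmx1 (n : nat) (Z : 'cV[U]_n) : lmx 1%:M Z = Z.
Proof.
apply/colP => i; rewrite mxE (bigD1 i)//= big1 ?addr0.
  by rewrite mxE eqxx scale1r.
by move=> j /negbTE ji; rewrite mxE eq_sym ji scale0r.
Qed.

Lemma lmxA (m n p : nat) (M : 'M[R]_(m, n)) (N : 'M[R]_(n, p))
    (Z : 'cV[U]_p) :
  lmx M (lmx N Z) = lmx (M *m N) Z.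
Proof.
apply/colP => i; rewrite !mxE.
under eq_bigr => j _ do rewrite mxE scaler_sumr.
rewrite exchange_big; apply: eq_bigr => k _.
rewrite mxE scaler_suml; apply: eq_bigr => j _.
by rewrite scalerA.
Qed.

End ScalarMatrixAction.

Lemma lmx_regular (R : comNzRingType) (m n : nat) (M : 'M[R]_(m, n))
    (z : 'cV[R^o]_n) :
  lmx M z = M *m z.
Proof. by apply/colP => i; rewrite !mxE. Qed.

Lemma map_lmx (R : comNzRingType) (U U' : lmodType R) (f : {linear U -> U'})
    (m n : nat) (M : 'M[R]_(m, n)) (Z : 'cV[U]_n) :
  map_mx f (lmx M Z) = lmx M (map_mx f Z).
Proof.
apply/colP => i; rewrite !mxE linear_sum; apply: eq_bigr => j _.
by rewrite linearZ mxE.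
Qed.

(** * Trajectories over a module *)

Definition in_horizon (T : horizon) (k : nat) : bool :=
  if T is Some N then (k <= N)%N else true.

Lemma in_horizon_le (T : horizon) (j k : nat) :
  (j <= k)%N -> in_horizon T k -> in_horizon T j.
Proof. by case: T => //= N; exact: leq_trans. Qed.

Lemma in_horizon_instant (T : horizon) (t : time T) : in_horizon T (instant t).
Proof. by case: T t => //= N t; rewrite -ltnS. Qed.

Lemma in_horizonP (T : horizon) (k : nat) :
  in_horizon T k -> exists t : time T, instant t = k.
Proof.
case: T => [N /= kN|_]; last by exists k.
by exists (inord k); rewrite /= inordK.
Qed.

Lemma restr_eqP (T : horizon) (U : Type) (z z' : nat -> U) :
  restr T z = restr T z' <-> forall k, in_horizon T k -> z k = z' k.
Proof.
split=> [zz' k /in_horizonP[t <-]|zz']; first exact: (congr1 (@^~ t) zz').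
by apply/funext => t; apply: zz'; exact: in_horizon_instant.
Qed.

Section Response.
Context (R : comNzRingType) (nx nv ny : nat).
Variables (A : 'M[R]_nx) (B : 'M[R]_(nx, nv)) (C : 'M[R]_(ny, nx))
  (D : 'M[R]_(ny, nv)).

Section OneModule.
Context (U : lmodType R).

Fixpoint state (x0 : 'cV[U]_nx) (v : nat -> 'cV[U]_nv) (k : nat) :
    'cV[U]_nx :=
  if k is k'.+1 then lmx A (state x0 v k') + lmx B (v k') else x0.

Definition output (x0 : 'cV[U]_nx) (v : nat -> 'cV[U]_nv) (k : nat) :
    'cV[U]_ny :=
  lmx C (state x0 v k) + lmx D (v k).

Definition explains (T : horizon) (x0 : 'cV[U]_nx) (v : nat -> 'cV[U]_nv)
    (y : nat -> 'cV[U]_ny) : Prop :=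
  forall k, in_horizon T k -> y k = output x0 v k.

(** Written through the solution of the recursion instead of the recursion
    itself, the equations at instant [k] involve only data of instants up to
    [k], so the state equation needs no care at the end of the horizon. *)
Definition solves (T : horizon) (x : nat -> 'cV[U]_nx)
    (v : nat -> 'cV[U]_nv) (y : nat -> 'cV[U]_ny) : Prop :=
  (forall k, in_horizon T k -> x k = state (x 0%N) v k) /\
  explains T (x 0%N) v y.

Lemma eq_state (T : horizon) (x0 : 'cV[U]_nx) (v v' : nat -> 'cV[U]_nv) k :
  (forall j, in_horizon T j -> v j = v' j) -> in_horizon T k ->
  state x0 v k = state x0 v' k.
Proof.
move=> vv'; elim: k => //= k IH Tk; have Tk' := in_horizon_le (leqnSn k) Tk.
by rewrite IH// vv'.
Qed.

Lemma eq_output (T : horizon) (x0 : 'cV[U]_nx) (v v' : nat -> 'cV[U]_nv) k :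
  (forall j, in_horizon T j -> v j = v' j) -> in_horizon T k ->
  output x0 v k = output x0 v' k.
Proof. by move=> vv' Tk; rewrite /output (eq_state x0 vv')// vv'. Qed.

Lemma stateE (x0 : 'cV[U]_nx) (v : nat -> 'cV[U]_nv) k :
  state x0 v k = lmx (A ^+ k) x0 + state 0 v k.
Proof.
elim: k => [|k IH] /=; first by rewrite expr0 lmx1 addr0.
by rewrite IH lmxD lmxA addrA exprS.
Qed.

Lemma outputE (x0 : 'cV[U]_nx) (v : nat -> 'cV[U]_nv) k :
  output x0 v k = lmx (C *m A ^+ k) x0 + output 0 v k.
Proof. by rewrite /output stateE lmxD lmxA addrA. Qed.

End OneModule.

Lemma map_state (U U' : lmodType R) (f : {linear U -> U'}) (x0 : 'cV[U]_nx)
    (v : nat -> 'cV[U]_nv) (k : nat) :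
  map_mx f (state x0 v k) = state (map_mx f x0) (fun j => map_mx f (v j)) k.
Proof. by elim: k => //= k IH; rewrite map_mxD !map_lmx IH. Qed.

Lemma map_output (U U' : lmodType R) (f : {linear U -> U'}) (x0 : 'cV[U]_nx)
    (v : nat -> 'cV[U]_nv) (k : nat) :
  map_mx f (output x0 v k) = output (map_mx f x0) (fun j => map_mx f (v j)) k.
Proof. by rewrite map_mxD !map_lmx map_state. Qed.

End Response.

(** * Recovering an initial state from inputs and outputs *)

Section Observability.

(** The ranks of the spans of finitely many [M j] are bounded by [n]; a span
    of maximal rank absorbs all the others. *)
Lemma finite_row_span (F : fieldType) (m n : nat) (p : pred nat)
    (M : nat -> 'M[F]_(m, n)) :
  exists K, forall k, p k -> (M k <= \sum_(j < K | p j) genmx (M j))%MS.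
Proof.
pose S K := (\sum_(j < K | p j) genmx (M j))%MS.
have S_le K K' : (K <= K')%N -> (S K <= S K')%MS.
  move=> KK'; apply/sumsmx_subP => j pj.
  exact: (sumsmx_sup (widen_ord KK' j)).
have [r [[K rK] rmax]] : exists r, (exists K, \rank (S K) = r) /\
    forall K, (\rank (S K) <= r)%N.
  have ex : exists r, `[< exists K, \rank (S K) = r >].
    by exists (\rank (S 0)); apply/asboolP; exists 0%N.
  have ub r : `[< exists K, \rank (S K) = r >] -> (r <= n)%N.
    by move=> /asboolP[K <-]; exact: rank_leq_row.
  case: (ex_maxnP ex ub) => r /asboolP rP rmax; exists r; split=> // K.
  by apply: rmax; apply/asboolP; exists K.
exists K => k pk.
have SK : (S (maxn K k.+1) <= S K)%MS.
  by rewrite -(geq_leqif (mxrank_leqif_sup (S_le _ _ (leq_maxl K k.+1)))) rK.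
apply: submx_trans SK.
have kK : (k < maxn K k.+1)%N by rewrite leq_max leqnn orbT.
by apply: (sumsmx_sup (Ordinal kK)) => //; rewrite genmxE.
Qed.

(** With [S] the row span of the family, [pinvmx S *m S] acts as the identity
    on the rows of every [M k], and its own rows lie in [S], so it is a
    combination of the [M j]. *)
Lemma joint_left_inverse (F : fieldType) (m n : nat) (p : pred nat)
    (M : nat -> 'M[F]_(m, n)) :
  exists (K : nat) (L : 'I_K -> 'M[F]_(n, m)), forall k, p k ->
    M k *m (\sum_(j < K | p j) L j *m M j) = M k.
Proof.
have [K MK] := finite_row_span p M; exists K.
set S := (\sum_(j < K | p j) genmx (M j))%MS in MK.
have /sub_sums_genmxP[L SL] : (pinvmx S *m S <= S)%MS by exact: submxMl.
by exists L => k pk; rewrite -SL mulmxA mulmxKpV// MK.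
Qed.

(** Subtracting the response to the input from the zero state leaves
    [C A^j x0] at instant [j].  The recovered state may differ from [x0], but
    only by an unobservable vector.  The matrices [L] are the same for all
    modules and all trajectories; this uniformity is what carries measurability
    and summability over to the state. *)
Lemma initial_state_reconstruction (F : fieldType) (nx nv ny : nat)
    (A : 'M[F]_nx) (B : 'M[F]_(nx, nv)) (C : 'M[F]_(ny, nx))
    (D : 'M[F]_(ny, nv)) (T : horizon) :
  exists (K : nat) (L : 'I_K -> 'M[F]_(nx, ny)),
    forall (U : lmodType F) (x0 : 'cV[U]_nx) v y,
      explains A B C D T x0 v y ->
      explains A B C D T
        (\sum_(j < K | in_horizon T j)
          lmx (L j) (y j - output A B C D 0 v j)) v y.
Proof.
have [K [L LP]] := joint_left_inverse (in_horizon T) (fun k => C *m A ^+ k).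
exists K, L => U x0 v y yE k Tk.
rewrite yE// outputE [RHS]outputE; congr (_ + _).
rewrite -[in LHS](LP k Tk) -[LHS]lmxA suml_lmx; congr (lmx _ _).
apply: eq_bigr => j Tj.
by rewrite yE// outputE addrK lmxA.
Qed.

End Observability.

(** * Realization behaviors *)

Section Trajectories.
Context (R : realType) (nx nv ny : nat).
Variables (A : 'M[R]_nx) (B : 'M[R]_(nx, nv)) (C : 'M[R]_(ny, nx))
  (D : 'M[R]_(ny, nv)).
Implicit Types (x : nat -> 'cV[R^o]_nx) (v : nat -> 'cV[R^o]_nv)
  (y : nat -> 'cV[R^o]_ny).

Lemma realization_behaviorP x v y :
  realization_behavior A B C D (x, v, y) <-> solves A B C D None x v y.
Proof.
split=> [xvy|[xE yE] k /=].
  have xE k : x k = state A B (x 0%N) v k.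
    by elim: k => //= k <-; rewrite !lmx_regular; case: (xvy k).
  split=> k _ //; rewrite /output -xE !lmx_regular; by case: (xvy k).
by split; rewrite ?[LHS]xE ?yE//= /output -xE// !lmx_regular.
Qed.

Lemma response_realization (x0 : 'cV[R^o]_nx) v :
  realization_behavior A B C D (state A B x0 v, v, output A B C D x0 v).
Proof. exact/realization_behaviorP. Qed.

(** A solution on the horizon is continued by keeping its input [v] beyond the
    horizon and letting the recursion produce state and output. *)
Lemma behavior3_realizationP (T : horizon) x v y :
  behavior3 T (realization_behavior A B C D) (restr3 T (x, v, y)) <->
  solves A B C D T x v y.
Proof.
split=> [[[[x' v'] y'] /realization_behaviorP[xE' yE']]|[xE yE]].
  case=> /restr_eqP xx' /restr_eqP vv' /restr_eqP yy' /=.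
  have x0 : x 0%N = x' 0%N by rewrite xx'//; case: T {xx' vv' yy'}.
  split=> k Tk; first by rewrite -xx'// xE'// x0; exact: eq_state vv' Tk.
  by rewrite -yy'// yE'// x0; exact: eq_output vv' Tk.
exists (state A B (x 0%N) v, v, output A B C D (x 0%N) v).
  exact: response_realization.
congr (_, _, _); apply/restr_eqP => k Tk; first by rewrite [RHS]xE.
by rewrite [RHS]yE.
Qed.

Lemma behavior2_realizationP (T : horizon) v y :
  behavior2 T (manifest (realization_behavior A B C D)) (restr2 T (v, y)) <->
  exists x0 : 'cV[R^o]_nx, explains A B C D T x0 v y.
Proof.
split=> [[[v' y'] [x /realization_behaviorP[xE yE]]]|[x0 yE]].
  case=> /restr_eqP vv' /restr_eqP yy'; exists (x 0%N) => k Tk.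
  by rewrite -yy'// [LHS]yE//; exact: eq_output vv' Tk.
exists (v, output A B C D x0 v).
  by exists (state A B x0 v); exact: response_realization.
by congr (_, _); apply/restr_eqP => k Tk; exact/esym/yE.
Qed.

End Trajectories.

(** * Coefficient behaviors *)

Section SquareSummable.
Context (R : realType).

Let sqnorm (n : nat) (z : 'cV[R]_n) : R := (z^T *m z) 0 0.

Let sqnormE (n : nat) (z : 'cV[R]_n) : sqnorm z = \sum_j z j 0 ^+ 2.
Proof. by rewrite /sqnorm mxE; apply: eq_bigr => j _; rewrite mxE expr2. Qed.

Let sqnorm_ge0 (n : nat) (z : 'cV[R]_n) : 0 <= sqnorm z.
Proof. by rewrite sqnormE sumr_ge0// => j _; exact: sqr_ge0. Qed.

Lemma ell2D (n : nat) (z w : nat -> 'cV[R]_n) :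
  ell2 z -> ell2 w -> ell2 (fun i => z i + w i).
Proof.
move=> z2 w2.
have zw i : sqnorm (z i + w i) <= 2 * (sqnorm (z i) + sqnorm (w i)).
  rewrite !sqnormE -big_split mulr_sumr; apply: ler_sum => j _ /=.
  by rewrite mxE; have := sqr_ge0 (z i j 0 - w i j 0); nra.
apply: (@le_lt_trans _ _ (2%:E * (\sum_(0 <= i <oo) (sqnorm (z i))%:E +
    \sum_(0 <= i <oo) (sqnorm (w i))%:E)))%E; last first.
  by apply: lte_mul_pinfty => //; exact: lte_add_pinfty.
rewrite -nneseriesD; [|by move=> i _ _; exact: sqnorm_ge0..].
rewrite -nneseriesZl; last by move=> i _; rewrite -EFinD lee_fin addr_ge0.
apply: lee_nneseries => [i _ _|i _]; first exact: sqnorm_ge0.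
by rewrite -EFinD -EFinM lee_fin zw.
Qed.

Lemma ell2_0 (n : nat) : ell2 (fun _ : nat => 0 : 'cV[R]_n).
Proof.
by rewrite /ell2 eseries0// => i _ _; rewrite mulmx0 mxE.
Qed.

Lemma ell2_sum (n : nat) (I : Type) (r : seq I) (p : pred I)
    (z : I -> nat -> 'cV[R]_n) :
  (forall j, p j -> ell2 (z j)) -> ell2 (fun i => \sum_(j <- r | p j) z j i).
Proof.
move=> z2; elim: r => [|j r IH].
  by under eq_fun do rewrite big_nil; exact: ell2_0.
under eq_fun do rewrite big_cons.
case: (p j) (z2 j) => [/(_ isT) zj|_] //; exact: ell2D.
Qed.

(** [M *m z] is the sum of the columns of [M] weighted by the entries of [z],
    and each weighted column is dominated by a multiple of [z]. *)
Lemma ell2_mulmx (m n : nat) (M : 'M[R]_(m, n)) (z : nat -> 'cV[R]_n) :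
  ell2 z -> ell2 (fun i => M *m z i).
Proof.
move=> z2.
have -> : (fun i => M *m z i) = (fun i => \sum_j z i j 0 *: col j M).
  apply/funext => i; apply/colP => k; rewrite mxE summxE.
  by apply: eq_bigr => j _; rewrite !mxE mulrC.
apply: ell2_sum => j _.
apply: (@le_lt_trans _ _ ((sqnorm (col j M))%:E *
    \sum_(0 <= i <oo) (sqnorm (z i))%:E)%E); last first.
  by apply: lte_mul_pinfty => //; exact: sqnorm_ge0.
rewrite -nneseriesZl; last by move=> i _; exact: sqnorm_ge0.
apply: lee_nneseries => [i _ _|i _]; first exact: sqnorm_ge0.
rewrite -EFinM lee_fin -/(sqnorm _) !sqnormE [leRHS]mulrC.
under eq_bigr => k _ do rewrite mxE exprMn.
rewrite -mulr_sumr ler_wpM2r ?sumr_ge0// => [k _|]; first exact: sqr_ge0.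
by rewrite (bigD1 j)//= lerDl sumr_ge0// => k _; exact: sqr_ge0.
Qed.

Lemma ell2B (n : nat) (z w : nat -> 'cV[R]_n) :
  ell2 z -> ell2 w -> ell2 (fun i => z i - w i).
Proof.
move=> z2 w2; apply: ell2D => //.
under eq_fun => i do rewrite -[w i]mul1mx -mulNmx.
exact: ell2_mulmx.
Qed.

Lemma ell2_lmx (m n : nat) (M : 'M[R]_(m, n)) (z : nat -> 'cV[R^o]_n) :
  ell2 z -> ell2 (fun i => lmx M (z i)).
Proof.
under [X in _ -> ell2 X]eq_fun do rewrite lmx_regular.
exact: ell2_mulmx.
Qed.

Lemma ell2_state (nx nv : nat) (A : 'M[R]_nx) (B : 'M[R]_(nx, nv))
    (x0 : nat -> 'cV[R^o]_nx) (v : nat -> nat -> 'cV[R^o]_nv) (k : nat) :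
  ell2 x0 -> (forall j, ell2 (v j)) ->
  ell2 (fun i => state A B (x0 i) (coef_traj v i) k).
Proof.
move=> x02 v2; elim: k => //= k IH; apply: ell2D; first exact: ell2_lmx.
by apply: (@ell2_lmx _ _ _ (v k)).
Qed.

Lemma ell2_output (nx nv ny : nat) (A : 'M[R]_nx) (B : 'M[R]_(nx, nv))
    (C : 'M[R]_(ny, nx)) (D : 'M[R]_(ny, nv)) (x0 : nat -> 'cV[R^o]_nx)
    (v : nat -> nat -> 'cV[R^o]_nv) (k : nat) :
  ell2 x0 -> (forall j, ell2 (v j)) ->
  ell2 (fun i => output A B C D (x0 i) (coef_traj v i) k).
Proof.
move=> x02 v2; apply: ell2D; first by apply: ell2_lmx; exact: ell2_state.
by apply: (@ell2_lmx _ _ _ (v k)).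
Qed.

End SquareSummable.

Section CoefficientBehavior.
Context (R : realType) (nx nv ny : nat).
Variables (A : 'M[R]_nx) (B : 'M[R]_(nx, nv)) (C : 'M[R]_(ny, nx))
  (D : 'M[R]_(ny, nv)).

(** The continuation produced by the recursion is square summable at each
    instant, as a finite combination of [x 0] and values of [v]. *)
Lemma coefficient_behaviorP (T : horizon) (x : nat -> nat -> 'cV[R]_nx)
    (v : nat -> nat -> 'cV[R]_nv) (y : nat -> nat -> 'cV[R]_ny) :
  ell2 (x 0%N) -> (forall k, ell2 (v k)) ->
  behavior3 T (coefficient_behavior A B C D) (restr3 T (x, v, y)) <->
  forall i, behavior3 T (realization_behavior A B C D)
    (restr3 T (coef_traj x i, coef_traj v i, coef_traj y i)).
Proof.
move=> x2 v2; split=> [[[[x' v'] y'] [_ _ _ sol]]|sol].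
  case=> /restr_eqP xx' /restr_eqP vv' /restr_eqP yy' i.
  exists (coef_traj x' i, coef_traj v' i, coef_traj y' i); first exact: sol.
  congr (_, _, _); apply/restr_eqP => k Tk.
  - exact: (congr1 (@^~ i) (xx' k Tk)).
  - exact: (congr1 (@^~ i) (vv' k Tk)).
  - exact: (congr1 (@^~ i) (yy' k Tk)).
have {}sol i := (behavior3_realizationP _ _ _ _ _ _ _ _).1 (sol i).
exists (fun k i => state A B (x 0%N i) (coef_traj v i) k, v,
        fun k i => output A B C D (x 0%N i) (coef_traj v i) k).
  split=> //= [k|k|i]; [exact: ell2_state|exact: ell2_output|].
  exact: response_realization.
congr (_, _, _); apply/restr_eqP => k Tk; apply/funext => i /=.
  exact/esym/(sol i).1.
exact/esym/(sol i).2.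
Qed.

Lemma manifest_coefficient_behaviorP (T : horizon)
    (v : nat -> nat -> 'cV[R]_nv) (y : nat -> nat -> 'cV[R]_ny) :
  (forall k, ell2 (v k)) -> (forall k, ell2 (y k)) ->
  behavior2 T (manifest (coefficient_behavior A B C D)) (restr2 T (v, y)) <->
  forall i, behavior2 T (manifest (realization_behavior A B C D))
    (restr2 T (coef_traj v i, coef_traj y i)).
Proof.
move=> v2 y2; split=> [[[v' y'] [x [_ _ _ sol]]]|sol].
  case=> /restr_eqP vv' /restr_eqP yy' i.
  exists (coef_traj v' i, coef_traj y' i).
    by exists (coef_traj x i); exact: sol.
  congr (_, _); apply/restr_eqP => k Tk.
  - exact: (congr1 (@^~ i) (vv' k Tk)).
  - exact: (congr1 (@^~ i) (yy' k Tk)).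
have [K [L LP]] := initial_state_reconstruction A B C D T.
pose x0 i : 'cV[R^o]_nx := \sum_(j < K | in_horizon T j)
  lmx (L j) (coef_traj y i j - output A B C D 0 (coef_traj v i) j).
have {}sol i : explains A B C D T (x0 i) (coef_traj v i) (coef_traj y i).
  by have /behavior2_realizationP[x0' /LP] := sol i.
have x02 : ell2 x0.
  apply: ell2_sum => j _; apply: ell2_lmx; apply: ell2B; first exact: y2.
  by apply: (@ell2_output _ _ _ _ _ _ _ _ (fun=> 0)) => //; exact: ell2_0.
exists (v, fun k i => output A B C D (x0 i) (coef_traj v i) k).
  exists (fun k i => state A B (x0 i) (coef_traj v i) k).
  split=> //= [k|k|i]; [exact: ell2_state|exact: ell2_output|].
  exact: response_realization.
by congr (_, _); apply/restr_eqP => k Tk; apply/funext => i; exact/esym/sol.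
Qed.

End CoefficientBehavior.

(** * Testing linear equations by families of functionals *)

Lemma near_iff (W : Type) (F : set_system W) (FF : Filter F)
    (P Q : W -> Prop) :
  (forall w, P w <-> Q w) ->
  (\forall w \near F, P w) <-> (\forall w \near F, Q w).
Proof. by move=> PQ; split; apply: filterS => w /PQ. Qed.

Section NearEvaluations.
Context (R : comNzRingType) (U : lmodType R).

(** Both almost sure validity and validity for every index are filters closed
    under countable intersections. *)
Definition countably_closed (W : Type) (F : set_system W) : Prop :=
  forall Q : nat -> W -> Prop, (forall n, \forall w \near F, Q n w) ->
  \forall w \near F, forall n, Q n w.

Definition null (W : Type) (F : set_system W) (f : W -> {linear U -> R^o})
    (u : U) : Prop :=
  \forall w \near F, f w u = 0.

Section OneEvaluation.
Context (W : Type) (F : set_system W) (FF : Filter F).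
Hypothesis Fcc : countably_closed F.
Variable f : W -> {linear U -> R^o}.

Lemma near_eqP (n : nat) (p : pred nat) (Z Z' : nat -> 'cV[U]_n) :
  (\forall w \near F, forall k, p k -> map_mx (f w) (Z k) = map_mx (f w) (Z' k))
  <-> forall k i, p k -> null F f ((Z k - Z' k) i 0).
Proof.
split=> [ZZ' k i pk|ZZ'].
  apply: filterS ZZ' => w /(_ k pk)/colP/(_ i); rewrite !mxE => fZ.
  by rewrite linearB /= fZ subrr.
apply: Fcc => k; case: (boolP (p k)) => [pk|_]; last exact: nearW.
have : \forall w \near F, forall i, f w ((Z k - Z' k) i 0) = 0.
  by apply: filter_forall => i; exact: ZZ'.
apply: filterS => w fZ _; apply/colP => i; apply/eqP.
by have := fZ i; rewrite !mxE linearB /= => /eqP; rewrite subr_eq0.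
Qed.

End OneEvaluation.

Context (W1 W2 : Type) (F1 : set_system W1) (F2 : set_system W2)
  (FF1 : Filter F1) (FF2 : Filter F2).
Hypotheses (Fcc1 : countably_closed F1) (Fcc2 : countably_closed F2).
Variables (f1 : W1 -> {linear U -> R^o}) (f2 : W2 -> {linear U -> R^o}).
Hypothesis null12 : forall u, null F1 f1 u <-> null F2 f2 u.

(** A family of functionals sees a linear equation only through the vanishing
    of the difference of its two sides, entry by entry. *)
Lemma near_eq_transfer (n : nat) (p : pred nat) (Z Z' : nat -> 'cV[U]_n) :
  (\forall w \near F1, forall k, p k ->
     map_mx (f1 w) (Z k) = map_mx (f1 w) (Z' k)) <->
  (\forall w \near F2, forall k, p k ->
     map_mx (f2 w) (Z k) = map_mx (f2 w) (Z' k)).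
Proof.
split=> /near_eqP ZZ'; apply/near_eqP => // k i pk; apply/null12; exact: ZZ'.
Qed.

Context (nx nv ny : nat) (A : 'M[R]_nx) (B : 'M[R]_(nx, nv))
  (C : 'M[R]_(ny, nx)) (D : 'M[R]_(ny, nv)) (T : horizon).

Lemma explains_map (f : {linear U -> R^o}) (x0 : 'cV[U]_nx)
    (v : nat -> 'cV[U]_nv) (y : nat -> 'cV[U]_ny) :
  explains A B C D T (map_mx f x0) (fun k => map_mx f (v k))
    (fun k => map_mx f (y k)) <->
  forall k, in_horizon T k -> map_mx f (y k) = map_mx f (output A B C D x0 v k).
Proof. by split=> yE k /yE; rewrite map_output. Qed.

Lemma solves_map (f : {linear U -> R^o}) (x : nat -> 'cV[U]_nx)
    (v : nat -> 'cV[U]_nv) (y : nat -> 'cV[U]_ny) :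
  solves A B C D T (fun k => map_mx f (x k)) (fun k => map_mx f (v k))
    (fun k => map_mx f (y k)) <->
  (forall k, in_horizon T k ->
     map_mx f (x k) = map_mx f (state A B (x 0%N) v k)) /\
  (forall k, in_horizon T k ->
     map_mx f (y k) = map_mx f (output A B C D (x 0%N) v k)).
Proof.
by split=> -[xE /explains_map yE]; split=> // k /xE; rewrite map_state.
Qed.

Lemma explains_transfer (x0 : 'cV[U]_nx) (v : nat -> 'cV[U]_nv)
    (y : nat -> 'cV[U]_ny) :
  (\forall w \near F1, explains A B C D T (map_mx (f1 w) x0)
     (fun k => map_mx (f1 w) (v k)) (fun k => map_mx (f1 w) (y k))) <->
  (\forall w \near F2, explains A B C D T (map_mx (f2 w) x0)
     (fun k => map_mx (f2 w) (v k)) (fun k => map_mx (f2 w) (y k))).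
Proof.
have f1E w := explains_map (f1 w) x0 v y.
have f2E w := explains_map (f2 w) x0 v y.
split=> sol; [apply: (near_iff FF2 f2E).2|apply: (near_iff FF1 f1E).2];
  apply/near_eq_transfer.
  exact: (near_iff FF1 f1E).1.
exact: (near_iff FF2 f2E).1.
Qed.

Lemma solves_transfer (x : nat -> 'cV[U]_nx) (v : nat -> 'cV[U]_nv)
    (y : nat -> 'cV[U]_ny) :
  (\forall w \near F1, solves A B C D T (fun k => map_mx (f1 w) (x k))
     (fun k => map_mx (f1 w) (v k)) (fun k => map_mx (f1 w) (y k))) <->
  (\forall w \near F2, solves A B C D T (fun k => map_mx (f2 w) (x k))
     (fun k => map_mx (f2 w) (v k)) (fun k => map_mx (f2 w) (y k))).
Proof.
have f1E w := solves_map (f1 w) x v y.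
have f2E w := solves_map (f2 w) x v y.
split=> sol; [apply: (near_iff FF2 f2E).2|apply: (near_iff FF1 f1E).2];
  apply/near_andP.
  by have /(near_iff FF1 f1E).1/near_andP[xE yE] := sol;
    split; apply/near_eq_transfer.
by have /(near_iff FF2 f2E).1/near_andP[xE yE] := sol;
  split; apply/near_eq_transfer.
Qed.

End NearEvaluations.

(** The initial state is chosen before the functional [f], whereas the states
    [z0] in the hypothesis may depend on [f] in an arbitrary way, in particular
    non-measurably when [f] is evaluation at a sample point. *)
Lemma common_initial_state (F : fieldType) (U : lmodType F) (nx nv ny : nat)
    (A : 'M[F]_nx) (B : 'M[F]_(nx, nv)) (C : 'M[F]_(ny, nx))
    (D : 'M[F]_(ny, nv)) (T : horizon) (v : nat -> 'cV[U]_nv)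
    (y : nat -> 'cV[U]_ny) :
  exists x0 : 'cV[U]_nx, forall f : {linear U -> F^o},
    (exists z0, explains A B C D T z0 (fun k => map_mx f (v k))
                  (fun k => map_mx f (y k))) ->
    explains A B C D T (map_mx f x0) (fun k => map_mx f (v k))
      (fun k => map_mx f (y k)).
Proof.
have [K [L LP]] := initial_state_reconstruction A B C D T.
exists (\sum_(j < K | in_horizon T j) lmx (L j) (y j - output A B C D 0 v j)).
move=> f [z0 /LP]; congr explains; rewrite raddf_sum; apply: eq_bigr => j _ /=.
by rewrite map_lmx map_mxB map_output map_mx0.
Qed.

(** * Square-integrable functions and their classes *)

Section SquareIntegrable.
Context (d : measure_display) (Omega : measurableType d) (R : realType)
  (P : probability Omega R).

Local Notation L2fun := (LfunType P (lee1n 2)).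

Lemma L2class_Lfun (Z : LspaceType2 P) : (Z : Omega -> R) \in Lfun P 2%:E.
Proof.
apply/andP; split; rewrite inE /=.
  exact: (@measurable_funPT _ _ _ _ (repr (LebesgueSpace.sort Z))).
exact: (@Lebesgue_finite _ _ _ _ _ _ Z).
Qed.

(** Representatives are functions, on which evaluation at a point is linear;
    on the classes it is so only up to null sets that depend on the
    operands. *)
Definition L2rep (Z : LspaceType2 P) : L2fun :=
  Lfun_Sub (lee1n 2) (L2class_Lfun Z).

Lemma L2fun_mfun (u : L2fun) : (u : Omega -> measurableTypeR R) \in mfun.
Proof. by rewrite inE /=; exact: (@measurable_funPT _ _ _ _ u). Qed.

Let ae_class (u : L2fun) : {mfun_ P, Omega >-> measurableTypeR R} :=
  (\pi_(aeEqMfun (measurableTypeR R) P) (mfun_Sub (L2fun_mfun u)))%qT.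

Let ae_classE (u : L2fun) : ae_class u = u %[ae P].
Proof.
have /eqmodP : (\pi_(aeEqMfun (measurableTypeR R) P) (repr (ae_class u)) =
    \pi_(aeEqMfun (measurableTypeR R) P) (mfun_Sub (L2fun_mfun u)))%qT.
  by rewrite reprK.
by move=> /asboolP.
Qed.

(** The representative chosen by the quotient agrees with [u] almost
   everywhere only, so its norm has to be computed again. *)
Let ae_class_finite (u : L2fun) : finite_norm P 2%:E (ae_class u).
Proof.
have := Lfunction_finite (lee1n 2) u; rewrite /finite_norm.
suff -> : 'N[P]_2%:E[EFin \o u]%E = 'N[P]_2%:E[EFin \o ae_class u]%E by [].
have mu2 (f : Omega -> R) : measurable_fun [set: Omega] f ->
    measurable_fun [set: Omega]
      ((fun w => `|(EFin \o f) w| `^ 2)%E : _ -> \bar R).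
  move=> mf; apply: (@measurableT_comp _ _ _ _ _ _ (fun x => x `^ 2)%E).
    exact: measurable_poweR.
  by apply: measurableT_comp => //; exact/measurable_EFinP.
rewrite unlock; congr (_ `^ _)%E; apply: ae_eq_integral => //.
- by apply: mu2; exact: (@measurable_funPT _ _ _ _ u).
- by apply: mu2; exact: (@measurable_funPT _ _ _ _ (repr (ae_class u))).
- by apply: filterS (ae_classE u) => w /[apply] /= ->.
Qed.

Definition L2class (u : L2fun) : LspaceType2 P :=
  LebesgueSpace.Pack (LebesgueSpace.Class
    (isFinLebesgue.Axioms_ _ _ _ _ _ _ (ae_class_finite u))).

Lemma L2classE (u : L2fun) : {ae P, forall w, L2class u w = u w}.
Proof. by apply: filterS (ae_classE u) => w /(_ I). Qed.

Definition point_eval (w : Omega) (u : L2fun) : R^o := u w.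

Lemma point_eval_linear (w : Omega) : linear (point_eval w).
Proof. by []. Qed.

HB.instance Definition _ (w : Omega) :=
  GRing.isLinear.Build R L2fun R^o *:%R (point_eval w) (point_eval_linear w).

Definition dot (u v : L2fun) : R := fine 'E_P[fun w => (u w * v w)%R].

Let mulL1 (u v : L2fun) : (fun w => u w * v w) \in Lfun P 1.
Proof. by apply: Lfun2_mul_Lfun1; exact: LfunP. Qed.

Lemma dotE (u v : L2fun) : (dot u v)%:E = 'E_P[fun w => (u w * v w)%R]%E.
Proof. by rewrite fineK// expectation_fin_num. Qed.

Lemma dotC (u v : L2fun) : dot u v = dot v u.
Proof. by rewrite /dot; under eq_fun do rewrite mulrC. Qed.

Lemma dot_linear (u : L2fun) : linear (dot u : L2fun -> R^o).
Proof.
move=> a v v'; apply: EFin_inj.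
transitivity (a%:E * (dot u v)%:E + (dot u v')%:E)%E; last first.
  by rewrite -EFinM -EFinD.
rewrite !dotE -(expectationZl a (mulL1 u v)) -expectationD//; last first.
  exact: Lfun_scale (mulL1 u v).
congr expectation; apply/funext => w /=.
transitivity (u w * (a * v w + v' w)) => //.
by ring.
Qed.

HB.instance Definition _ (u : L2fun) :=
  GRing.isLinear.Build R L2fun R^o *:%R (dot u : L2fun -> R^o) (dot_linear u).

Lemma dot_ae (u v v' : L2fun) :
  {ae P, forall w, v w = v' w} -> dot u v = dot u v'.
Proof.
move=> vv'; rewrite /dot unlock; congr fine; apply: ae_eq_integral => //.
- apply/measurable_EFinP.
  by have /andP[/[!inE]] := mulL1 u v.
- apply/measurable_EFinP.
  by have /andP[/[!inE]] := mulL1 u v'.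
- by apply: filterS vv' => w -> _.
Qed.

Lemma dot_Lnorm (u : L2fun) : dot u u = fine ('N[P]_2%:E[EFin \o u])%E ^+ 2.
Proof.
apply: EFin_inj; rewrite dotE -powR_mulrn ?fine_ge0 ?Lnorm_ge0//.
rewrite -poweR_EFin (finite_norm_fine u) powR_Lnorm ?pnatr_eq0// unlock.
apply: eq_integral => w _ /=.
by rewrite powR_mulrn// real_normK ?num_real// expr2.
Qed.

Lemma dot_eq0 (u : L2fun) : dot u u = 0 -> {ae P, forall w, u w = 0}.
Proof.
rewrite dot_Lnorm => /eqP; rewrite expf_eq0 /= => /eqP /fine_Lnormr_eq0.
by apply: filterS => w /(_ I).
Qed.

(** If all coefficients of [u] vanish, [u] is orthogonal to every finite
    combination [S] of the [phi i], so the norm of [u - S] is at least that of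
    [u]; since [S] can be taken arbitrarily close to [u], the norm of [u] is
    0. *)
Lemma ae0_coefP (phi : nat -> LspaceType2 P) (u : L2fun) :
  orthogonal_basis phi ->
  {ae P, forall w, u w = 0} <-> forall i, dot (L2rep (phi i)) u = 0.
Proof.
move=> [_ _ dense]; split=> [u0 i|phiu].
  by rewrite (@dot_ae _ _ 0)// linear0.
(* Totality of the basis speaks of classes, so [u] is replaced by the
   representative [Z] of its class, which has the same products. *)
have class_dot v : dot v (L2rep (L2class u)) = dot v u.
  by apply: dot_ae; exact: L2classE.
suff : dot (L2rep (L2class u)) (L2rep (L2class u)) = 0.
  move=> /dot_eq0; apply: filterS2 (L2classE u) => w.
  by rewrite -[L2rep _ w]/(L2class u w) => <-.
set Z := L2rep (L2class u); apply/eqP; rewrite eq_le.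
have -> : 0 <= dot Z Z by rewrite dot_Lnorm sqr_ge0.
rewrite andbT.
apply/ler_addgt0Pl => e e0; rewrite addr0.
have [|n [c]] := dense (L2class u) (Num.sqrt e); first by rewrite sqrtr_gt0.
pose S : L2fun := \sum_(i < n) c i *: L2rep (phi i).
have dotZS : dot Z S = 0.
  rewrite linear_sum big1// => i _.
  by rewrite linearZ /= dotC class_dot phiu scaler0.
have -> : EFin \o (fun w => L2class u w - \sum_(i < n) c i * phi i w) =
    EFin \o (Z - S : L2fun).
  apply/funext => w /=; congr EFin.
  rewrite -[RHS]/(point_eval w (Z - S)) linearB; congr (_ - _).
  by rewrite linear_sum; apply: eq_bigr => i _; rewrite linearZ.
rewrite -(finite_norm_fine (Z - S)) lte_fin => ltZS.
have : dot (Z - S) (Z - S) <= e.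
  rewrite dot_Lnorm -(sqr_sqrtr (ltW e0)) lerXn2r ?nnegrE ?sqrtr_ge0//.
  - by rewrite fine_ge0// Lnorm_ge0.
  - exact: ltW.
rewrite linearB /= ![dot (Z - S) _]dotC !linearB /= dotZS [dot S Z]dotC dotZS.
have : 0 <= dot S S by rewrite dot_Lnorm sqr_ge0.
by rewrite subr0 oppr0 add0r opprK => S0; apply: le_trans; rewrite lerDl.
Qed.

End SquareIntegrable.

(** * Random behaviors *)

Section Expansion.
Context (d : measure_display) (Omega : measurableType d) (R : realType)
  (P : probability Omega R).

Local Notation L2fun := (LfunType P (lee1n 2)).

Lemma ae_countably_closed : countably_closed (almost_everywhere P).
Proof. by move=> Q; exact: ae_foralln. Qed.

Lemma globally_countably_closed (W : Type) (S : set W) :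
  countably_closed (globally S).
Proof. by move=> Q QS w Sw n; exact: QS. Qed.

Definition coef_eval (phi : nat -> LspaceType2 P) (i : nat) (u : L2fun) : R^o :=
  dot (L2rep (phi i)) u / inner (phi i) (phi i).

Lemma coef_eval_linear (phi : nat -> LspaceType2 P) (i : nat) :
  linear (coef_eval phi i).
Proof.
move=> a u v; rewrite /coef_eval linearP /= mulrDl; congr (_ + _).
exact: (esym (mulrA a _ _)).
Qed.

HB.instance Definition _ (phi : nat -> LspaceType2 P) (i : nat) :=
  GRing.isLinear.Build R L2fun R^o *:%R (coef_eval phi i)
    (coef_eval_linear phi i).

Lemma null_coef_eval (phi : nat -> LspaceType2 P) (u : L2fun) :
  orthogonal_basis phi ->
  null (almost_everywhere P) (@point_eval _ _ _ P) u <->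
  null (globally [set: nat]) (coef_eval phi) u.
Proof.
move=> phi_basis; have [phi_neq0 _ _] := phi_basis.
apply: iff_trans (ae0_coefP u phi_basis) _; split=> [u0 i _|u0 i].
  by rewrite /= /coef_eval u0 mul0r.
have /eqP := u0 i I.
by rewrite mulf_eq0 invr_eq0 (negbTE (phi_neq0 i)) orbF => /eqP.
Qed.

Lemma realizationE (n : nat) (Z : nat -> L2vec P n) (w : Omega) :
  realization Z w =
  fun k => map_mx (point_eval w) (map_mx (@L2rep _ _ _ P) (Z k)).
Proof. by apply/funext => k; apply/colP => j; rewrite !mxE. Qed.

Lemma coef_trajE (phi : nat -> LspaceType2 P) (n : nat) (Z : nat -> L2vec P n)
    (i : nat) :
  coef_traj (fun k => expansion_coef phi (Z k)) i =
  fun k => map_mx (coef_eval phi i) (map_mx (@L2rep _ _ _ P) (Z k)).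
Proof. by apply/funext => k; apply/colP => j; rewrite !mxE. Qed.

Lemma realization_L2class (n : nat) (Z : nat -> 'cV[L2fun]_n) :
  {ae P, forall w, realization (fun k => map_mx (@L2class _ _ _ P) (Z k)) w =
     fun k => map_mx (point_eval w) (Z k)}.
Proof.
have : {ae P, forall w, forall k j, L2class (Z k j 0) w = Z k j 0 w}.
  apply: ae_foralln => k; apply: filter_forall => j; exact: L2classE.
apply: filterS => w ZE; apply/funext => k; apply/colP => j.
by rewrite !mxE ZE.
Qed.

End Expansion.

Section RandomBehavior.
Context (d : measure_display) (Omega : measurableType d) (R : realType)
  (P : probability Omega R) (nx nv ny : nat) (A : 'M[R]_nx)
  (B : 'M[R]_(nx, nv)) (C : 'M[R]_(ny, nx)) (D : 'M[R]_(ny, nv)) (T : horizon).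
Implicit Types (X : nat -> L2vec P nx) (V : nat -> L2vec P nv)
  (Y : nat -> L2vec P ny).

Local Notation rep Z := (fun k => map_mx (@L2rep _ _ _ P) (Z k)).

(** From pointwise solutions on the horizon, one gets a random trajectory on
    the whole time axis by running the recursion on square-integrable
    functions. *)
Lemma random_behaviorP X V Y :
  behavior3 T (random_behavior P A B C D) (restr3 T (X, V, Y)) <->
  {ae P, forall w, behavior3 T (realization_behavior A B C D)
     (restr3 T (realization X w, realization V w, realization Y w))}.
Proof.
split=> [[[[X' V'] Y'] sol]|sol].
  case=> /restr_eqP XX' /restr_eqP VV' /restr_eqP YY'.
  apply: filterS sol => w sol.
  exists (realization X' w, realization V' w, realization Y' w) => //.
  by congr (_, _, _); apply/restr_eqP => k Tk; apply/colP => j; rewrite !mxE;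
    rewrite ?XX' ?VV' ?YY'.
pose sX := state A B (rep X 0%N) (rep V).
pose sY := output A B C D (rep X 0%N) (rep V).
(* On the horizon the classes [X k] themselves are kept, because the
   restrictions have to be equal as families of classes. *)
pose X' k := if in_horizon T k then X k else map_mx (@L2class _ _ _ P) (sX k).
pose Y' k := if in_horizon T k then Y k else map_mx (@L2class _ _ _ P) (sY k).
exists (X', V, Y'); last first.
  by congr (_, _, _); apply/restr_eqP => k Tk; rewrite /X' /Y' /= Tk.
apply: filterS3 sol (realization_L2class sX) (realization_L2class sY).
move=> w /behavior3_realizationP[XE YE] sXE sYE /=.
have -> : realization X' w = state A B (realization X w 0%N) (realization V w).
  apply/funext => k; rewrite [LHS]/realization /X'; case: ifPn => Tk.
    by rewrite -XE.
  rewrite [LHS](_ : _ = map_mx (point_eval w) (sX k)).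
    by rewrite map_state !realizationE.
  exact: (congr1 (@^~ k) sXE).
have -> : realization Y' w =
    output A B C D (realization X w 0%N) (realization V w).
  apply/funext => k; rewrite [LHS]/realization /Y'; case: ifPn => Tk.
    by rewrite -YE.
  rewrite [LHS](_ : _ = map_mx (point_eval w) (sY k)).
    by rewrite map_output !realizationE.
  exact: (congr1 (@^~ k) sYE).
exact: response_realization.
Qed.

(** The states that exist for each sample point need not depend measurably on
    it; those reconstructed from [V] and [Y] are square integrable. *)
Lemma square_integrable_state V Y :
  {ae P, forall w, behavior2 T (manifest (realization_behavior A B C D))
     (restr2 T (realization V w, realization Y w))} ->
  exists X, {ae P, forall w, behavior3 T (realization_behavior A B C D)
     (restr3 T (realization X w, realization V w, realization Y w))}.
Proof.
move=> sol; have [x0 x0P] := common_initial_state A B C D T (rep V) (rep Y).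
pose sX := state A B x0 (rep V).
exists (fun k => map_mx (@L2class _ _ _ P) (sX k)).
apply: filterS2 sol (realization_L2class sX) => w.
move=> /behavior2_realizationP + sXE; rewrite sXE !realizationE => /x0P YE.
apply/behavior3_realizationP; split=> k Tk /=; first by rewrite map_state.
exact: YE.
Qed.

End RandomBehavior.

Lemma behavior3_manifest (T : horizon) (U1 U2 U3 : Type)
    (S : set ((nat -> U1) * (nat -> U2) * (nat -> U3))) x v y :
  behavior3 T S (restr3 T (x, v, y)) ->
  behavior2 T (manifest S) (restr2 T (v, y)).
Proof.
move=> [[[x' v'] y'] Sxvy [_ vv' yy']]; exists (v', y'); first by exists x'.
by congr (_, _).
Qed.

(** * The equivalences *)

Theorem theorem13 (R : realType) (nx nv ny : nat)
    (A : 'M[R]_nx) (B : 'M[R]_(nx, nv)) (C : 'M[R]_(ny, nx))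
    (D : 'M[R]_(ny, nv))
    (d : measure_display) (Omega : measurableType d) (P : probability Omega R)
    (sepP : countably_generated Omega)
    (phi : nat -> LspaceType2 P) (phi_basis : orthogonal_basis phi)
    (X : nat -> L2vec P nx) (V : nat -> L2vec P nv) (Y : nat -> L2vec P ny)
    (x : nat -> nat -> 'cV[R]_nx) (v : nat -> nat -> 'cV[R]_nv)
    (y : nat -> nat -> 'cV[R]_ny)
    (xE : forall k, x k = expansion_coef phi (X k))
    (vE : forall k, v k = expansion_coef phi (V k))
    (yE : forall k, y k = expansion_coef phi (Y k))
    (x_ell2 : forall k, ell2 (x k)) (v_ell2 : forall k, ell2 (v k))
    (y_ell2 : forall k, ell2 (y k))
    (T : horizon) :
  [<-> {ae P, forall w, behavior3 T (realization_behavior A B C D)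
         (restr3 T (realization X w, realization V w, realization Y w))};
       behavior3 T (random_behavior P A B C D) (restr3 T (X, V, Y));
       behavior3 T (coefficient_behavior A B C D) (restr3 T (x, v, y));
       forall i, behavior3 T (realization_behavior A B C D)
         (restr3 T (coef_traj x i, coef_traj v i, coef_traj y i))] /\
  [<-> {ae P, forall w, behavior2 T (manifest (realization_behavior A B C D))
         (restr2 T (realization V w, realization Y w))};
       behavior2 T (manifest (random_behavior P A B C D)) (restr2 T (V, Y));
       behavior2 T (manifest (coefficient_behavior A B C D)) (restr2 T (v, y));
       forall i, behavior2 T (manifest (realization_behavior A B C D))
         (restr2 T (coef_traj v i, coef_traj y i))].
Proof.
have ae_cc := @ae_countably_closed _ _ _ P.
have all_cc := @globally_countably_closed _ [set: nat].
have ae_filt : Filter (almost_everywhere P) by exact: ae_filter_ringOfSetsType.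
have all_filt := globally_filter [set: nat].
have nullP u := null_coef_eval u phi_basis.
pose rep n (Z : nat -> L2vec P n) k := map_mx (@L2rep _ _ _ P) (Z k).
have {xE} xE i : coef_traj x i = fun k => map_mx (coef_eval phi i) (rep _ X k).
  by rewrite (funext xE) coef_trajE.
have {vE} vE i : coef_traj v i = fun k => map_mx (coef_eval phi i) (rep _ V k).
  by rewrite (funext vE) coef_trajE.
have {yE} yE i : coef_traj y i = fun k => map_mx (coef_eval phi i) (rep _ Y k).
  by rewrite (funext yE) coef_trajE.
have iii_iv := coefficient_behaviorP A B C D T y (x_ell2 0%N) v_ell2.
have iii_iv_io := manifest_coefficient_behaviorP A B C D T v_ell2 y_ell2.
have i_iv : {ae P, forall w, behavior3 T (realization_behavior A B C D)
      (restr3 T (realization X w, realization V w, realization Y w))} <->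
    forall i, behavior3 T (realization_behavior A B C D)
      (restr3 T (coef_traj x i, coef_traj v i, coef_traj y i)).
  have tr := solves_transfer ae_filt all_filt ae_cc all_cc nullP A B C D T
    (rep _ X) (rep _ V) (rep _ Y).
  split=> [sol i|sol].
    apply/behavior3_realizationP; rewrite xE vE yE.
    apply: (tr.1 _ i I); apply: filterS sol => w /behavior3_realizationP.
    by rewrite !realizationE.
  apply: (filterS _ (tr.2 _)) => [w solw|i _].
    by apply/behavior3_realizationP; rewrite !realizationE.
  by have /behavior3_realizationP := sol i; rewrite xE vE yE.
have i_iv_io : {ae P, forall w,
      behavior2 T (manifest (realization_behavior A B C D))
      (restr2 T (realization V w, realization Y w))} <->
    forall i, behavior2 T (manifest (realization_behavior A B C D))
      (restr2 T (coef_traj v i, coef_traj y i)).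
  have [x0 x0P] := common_initial_state A B C D T (rep _ V) (rep _ Y).
  have tr := explains_transfer ae_filt all_filt ae_cc all_cc nullP A B C D T
    x0 (rep _ V) (rep _ Y).
  split=> [sol i|sol].
    apply/behavior2_realizationP; rewrite vE yE.
    exists (map_mx (coef_eval phi i) x0); apply: (tr.1 _ i I).
    apply: filterS sol => w /behavior2_realizationP.
    by rewrite !realizationE => /x0P.
  apply: (filterS _ (tr.2 _)) => [w solw|i _].
    apply/behavior2_realizationP; rewrite !realizationE.
    by exists (map_mx (point_eval w) x0).
  by have /behavior2_realizationP := sol i; rewrite vE yE => /x0P.
split.
  tfae.
  - by move=> /random_behaviorP.
  - by move=> /random_behaviorP/i_iv/iii_iv.
  - by move=> /iii_iv.
  - by move=> /i_iv.
tfae.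
- move=> /square_integrable_state[Z /random_behaviorP].
  exact: behavior3_manifest.
- move=> [[V' Y'] [Z sol] [/restr_eqP VV' /restr_eqP YY']].
  apply/iii_iv_io/i_iv_io; apply: filterS sol => w sol.
  exists (realization V' w, realization Y' w).
    by exists (realization Z w).
  by congr (_, _); apply/restr_eqP => k Tk; apply/colP => j; rewrite !mxE;
    rewrite ?VV' ?YY'.
- by move=> /iii_iv_io.
- by move=> /i_iv_io.
Qed.
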